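(* Let $\mathbb{X}=\{a,b,c\}$ (three distinct states), with $\mathbb{P}_a(X_1=c)=0$ and $\mathbb{P}_x(X_1=y)>0$ for all $(x,y)\in\mathbb{X}\times\mathbb{X}$ with $(x,y)\ne(a,c)$. Given $M>0$, define the payoff functions by $$\begin{aligned} f_1(a)&=1,& g_1(a)&=M^2,& f_2(a)&=M,& g_2(a)&=M+1,\\ f_1(b)&=M,& g_1(b)&=M+1,& f_2(b)&=1,& g_2(b)&=2,\\ f_1(c)&=1,& g_1(c)&=2,& f_2(c)&=M^2,& g_2(c)&=M^2+1, \end{aligned}$$ and $h_i(x)=\tfrac12(f_i(x)+g_i(x))$ for all $x\in\mathbb{X}$ and $i\in\{1,2\}$. Then, for all $M>0$ large enough (with the transition probabilities and the discount functions $\delta_1,\delta_2$ fixed), the condition ''for each $i\in\{1,2\}$, $(\delta_i(t)g_i(X_t^x))_{t\ge0}$ is a supermartingale for all $x\in\mathbb{X}$'' is violated, and there exists no soft inter-personal equilibrium.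
   Context: Setting (nonzero-sum Dynkin game). $\mathbb{Z}_+=\{0,1,2,\dots\}$. $X=(X_t)_{t\in\mathbb{Z}_+}$ is a time-homogeneous Markov chain with values in $\mathbb{X}$ (here finite, with $\mathcal{B}=2^{\mathbb{X}}$), on the path space of functions $\mathbb{Z}_+\to\mathbb{X}$; $(\mathcal{F}_t)$ is the filtration generated by $X$, $\mathcal{T}$ is the set of $(\mathcal{F}_t)$-stopping times (allowed to take the value $+\infty$), $X^x$ is the process $X$ with $X_0=x$, $\mathbb{P}_x$ is its law, and $\mathbb{E}_x$ the corresponding expectation. For $i\in\{1,2\}$, the discount function $\delta_i:\mathbb{Z}_+\to[0,1]$ is strictly decreasing with $\delta_i(0)=1$ and $\delta_i(s)\delta_i(t)\le\delta_i(s+t)$ for all $s,t\in\mathbb{Z}_+$. For payoff functions $f_i,g_i,h_i:\mathbb{X}\to[0,\infty)$ and $\tau,\sigma\in\mathcal{T}$, $$F_i(\tau,\sigma):=\delta_i(\tau)f_i(X_\tau)1_{\{\tau<\sigma\}}+\delta_i(\sigma)g_i(X_\sigma)1_{\{\tau>\sigma\}}+\delta_i(\tau)h_i(X_\tau)1_{\{\tau=\sigma\}},$$ with $F_i(\tau,\sigma):=\limsup_{t\to\infty}\delta_i(t)h_i(X_t)$ on $\{\tau=\sigma=+\infty\}$, and $J_i(x,\tau,\sigma):=\mathbb{E}_x[F_i(\tau,\sigma)]$. Here $\tau$ is Player $i$'s stopping time and $\sigma$ the other player's. Stopping policies are sets $S\in\mathcal{B}$. Put $\rho_S:=\inf\{t\ge0:X_t\in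 S\}$ and $\rho_S^+:=\inf\{t>0:X_t\in S\}$ ($\inf\emptyset=\infty$). Equilibria. For $S,T\in\mathcal{B}$ let $$\Theta_i^T(S):=\{x\in S: J_i(x,0,\rho_T)\ge J_i(x,\rho_S^+,\rho_T)\}\cup\{x\notin S: J_i(x,0,\rho_T)>J_i(x,\rho_S^+,\rho_T)\}.$$ $S$ is an intra-personal equilibrium of Player $i$ with respect to $T$ if $\Theta_i^T(S)=S$; $\mathcal{E}_i^T$ is the set of these. $(S,T)\in\mathcal{B}\times\mathcal{B}$ is a soft inter-personal equilibrium if $S\in\mathcal{E}_1^T$ and $T\in\mathcal{E}_2^S$. *)

(* Defs.v *)
From HB Require Import structures.
From mathcomp Require Import all_boot all_order all_algebra.
From mathcomp Require Import all_classical all_reals all_analysis.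

Set Implicit Arguments.
Unset Strict Implicit.
Unset Printing Implicit Defensive.
Import Order.TTheory GRing.Theory Num.Theory.
Import numFieldNormedType.Exports.
Local Open Scope classical_set_scope.
Local Open Scope ring_scope.

Section PathSpace.
Context (X : pointedType).

(* [X] carries the sigma-algebra of all its subsets. *)
Definition cylinders (I : set nat) : set (set (nat -> X)) :=
  [set A | exists t (B : set X), I t /\ A = [set w | B (w t)]].

Definition pathspace := g_sigma_algebraType (cylinders setT).

HB.instance Definition _ := Measurable.on pathspace.

(* The sigma-algebra generated by X_0, ..., X_t. *)
Definition natural_filtration (t : nat) : set (set pathspace) :=
  <<s cylinders [set s | (s <= t)%N] >>.

End PathSpace.

Section Conditioning.
Context {d : measure_display} {T : measurableType d} {R : realType}.
Variable P : probability T R.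

Definition measurable_wrt (G : set (set T)) (Z : T -> R) : Prop :=
  forall B : set R, measurable B -> G (Z @^-1` B).

(* [Z] is a version of E[Y | G], for integrable [Y]. *)
Definition is_cond_exp (G : set (set T)) (Y Z : T -> R) : Prop :=
  [/\ measurable_wrt G Z,
      P.-integrable setT (EFin \o Z) &
      forall A, G A ->
        (\int[P]_(w in A) (Z w)%:E = \int[P]_(w in A) (Y w)%:E)%E].

Definition supermartingale (F : nat -> set (set T)) (Y : nat -> T -> R) :
    Prop :=
  forall t,
    [/\ measurable_wrt (F t) (Y t),
        P.-integrable setT (EFin \o Y t) &
        exists2 Z : T -> R, is_cond_exp (F t) (Y t.+1) Z &
          {ae P, forall w, Z w <= Y t w}].

End Conditioning.

Section MarkovChain.
Context {X : pointedType} {R : realType}.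

(* The coordinate process started at x under P x:
   P_x(X_0 = x) = 1 and P_x(X_(t+1) \in B | F_t) = P_(X_t)(X_1 \in B). *)
Definition markov_chain (P : X -> probability (pathspace X) R) : Prop :=
  (forall x, P x [set w : pathspace X | w 0%N = x] = 1%E) /\
  (forall x t (B : set X),
     is_cond_exp (P x) (natural_filtration t)
       (\1_[set w : pathspace X | B (w t.+1)])
       (fun w : pathspace X =>
          fine (P (w t) [set w' : pathspace X | B (w' 1%N)]))).

End MarkovChain.

Definition discount_function {R : realType} (delta : nat -> R) : Prop :=
  [/\ forall t, 0 <= delta t <= 1,
      delta 0%N = 1,
      forall s t, (s < t)%N -> delta t < delta s &
      forall s t, delta s * delta t <= delta (s + t)%N].

(* Values in [option nat] are times in {0, 1, ...} together with +oo,
   represented by [None]. *)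
Definition inf_time (A : pred nat) : option nat :=
  if pselect (exists t, A t) is left exA then Some (ex_minn exA) else None.

Section DynkinGame.
Context {X : pointedType} {R : realType}.
Variable P : X -> probability (pathspace X) R.

Definition rho (S : set X) (w : pathspace X) : option nat :=
  inf_time (fun t => w t \in S).

Definition rho_plus (S : set X) (w : pathspace X) : option nat :=
  inf_time (fun t => (0 < t)%N && (w t \in S)).

(* [tau] is the player's own stopping time, [sigma] the opponent's. *)
Definition F (delta : nat -> R) (f g h : X -> R)
    (tau sigma : pathspace X -> option nat) (w : pathspace X) : R :=
  match tau w, sigma w with
  | Some s, Some t =>
      if (s < t)%N then delta s * f (w s)
      else if (t < s)%N then delta t * g (w t)
      else delta s * h (w s)
  | Some s, None => delta s * f (w s)
  | None, Some t => delta t * g (w t)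
  | None, None => limn_sup (fun t => delta t * h (w t))
  end.

Definition J (delta : nat -> R) (f g h : X -> R) (x : X)
    (tau sigma : pathspace X -> option nat) : \bar R :=
  ('E_(P x)[F delta f g h tau sigma])%E.

Definition Theta (delta : nat -> R) (f g h : X -> R) (T S : set X) : set X :=
  let stop x := J delta f g h x (fun=> Some 0%N) (rho T) in
  let continue x := J delta f g h x (rho_plus S) (rho T) in
  [set x | S x /\ (stop x >= continue x)%E] `|`
  [set x | ~ S x /\ (stop x > continue x)%E].

Definition intra_equilibrium (delta : nat -> R) (f g h : X -> R)
    (T S : set X) : Prop :=
  Theta delta f g h T S = S.

End DynkinGame.

Variant player := player1 | player2.

Definition soft_inter_equilibrium {X : pointedType} {R : realType}
    (P : X -> probability (pathspace X) R) (delta : player -> nat -> R)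
    (f g h : player -> X -> R) (S T : set X) : Prop :=
  intra_equilibrium P (delta player1) (f player1) (g player1) (h player1) T S
  /\
  intra_equilibrium P (delta player2) (f player2) (g player2) (h player2) S T.

Variant state := sa | sb | sc.

Definition state_to_ord (x : state) : 'I_3 :=
  match x with sa => inord 0 | sb => inord 1 | sc => inord 2 end.

Definition state_of_ord (i : 'I_3) : state :=
  match val i with 0 => sa | 1 => sb | _ => sc end%N.

Lemma state_to_ordK : cancel state_to_ord state_of_ord.
Proof. by case; rewrite /state_of_ord /= inordK. Qed.

HB.instance Definition _ := Finite.copy state (can_type state_to_ordK).
HB.instance Definition _ := isPointed.Build state sa.

Section Payoffs.
Context {R : realType}.
Variable M : R.

Definition payoff_f (i : player) (x : state) : R :=
  match i, x with
  | player1, sa => 1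
  | player1, sb => M
  | player1, sc => 1
  | player2, sa => M
  | player2, sb => 1
  | player2, sc => M ^+ 2
  end.

Definition payoff_g (i : player) (x : state) : R :=
  match i, x with
  | player1, sa => M ^+ 2
  | player1, sb => M + 1
  | player1, sc => 2
  | player2, sa => M + 1
  | player2, sb => 2
  | player2, sc => M ^+ 2 + 1
  end.

Definition payoff_h (i : player) (x : state) : R :=
  2^-1 * (payoff_f i x + payoff_g i x).

End Payoffs.

(* Main.v *)
Require Import Defs.
From HB Require Import structures.
From mathcomp Require Import all_boot all_order all_algebra.
From mathcomp Require Import all_classical all_reals all_analysis.
From mathcomp Require Import measurable_realfun ring lra.

(** For M large the supermartingale condition fails at once: from b the chain
    jumps to a, where g_1 is M^2, with positive probability, so that
    E_b[delta_1(1) g_1(X_1)] is of order M^2 while g_1(b) = M + 1.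

    For equilibria the point is that each player is drawn towards a payoff of
    order M^2 or M wherever a discounted positive probability of obtaining it
    beats stopping now. Let (S, T) be a soft equilibrium. Since h < g, no player
    stops where the other does, so S and T are disjoint
    ([equilibria_disjoint]). Call a state stopped if it lies in S or T.

    The state c is stopped: otherwise Player 2 refuses M^2 at c in favour of at
    most delta_2(1) (M^2 + 1) later ([c_stopped]). Moreover, if a is not in T
    then b is stopped: otherwise Player 1 refuses M at b, although the game then
    ends almost surely, with the first visit to c at the latest, and never pays
    Player 1 more than 2 ([b_stopped]).

    Suppose c is in S. If b were stopped, or if a were in T, then Player 1, who
    gets 1 at c, would rather wait for a payoff of order M or M^2 at the next
    step; so a is not in T and b is not stopped, against [b_stopped].

    Suppose c is in T. Then b is not in T, for Player 2 would rather wait for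
    M^2 at c.
    - If a is not in T, then b is stopped, so b is in S. Then a is not in S,
      for Player 1 would wait for M at b. So a is not stopped; but the chain
      cannot jump from a to c, hence from a it meets b before c, and Player 2
      refuses M at a for less ([a_stopped]).
    - If a is in T and b in S, Player 1 would rather wait at b for M^2 at a.
    - If a is in T and b is not in S, Player 2 would rather wait at a for M^2 at
      c, reached through b in two steps.

    Expectations of the game payoff are only ever compared with those of step
    functions, so its measurability plays no role: lower bounds come from
    [expectation_ge_cst] on an event fixing the first steps of the path, upper
    bounds from [expectation_le_cst] outside a null set. The two null sets,
    paths that never visit c and paths with a jump from a to c, come from the
    Markov property ([avoids_forever_ae], [forbidden_transition_ae]). *)

Set Implicit Arguments.
Unset Strict Implicit.
Unset Printing Implicit Defensive.
Import Order.TTheory GRing.Theory Num.Theory.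
Local Open Scope classical_set_scope.
Local Open Scope ring_scope.

(** * Expectation bounds without measurability *)

Section Expectation.
Context {d : measure_display} {T : measurableType d} {R : realType}.
Variable P : probability T R.

(** The integral of a nonnegative function is the supremum of the integrals of
    the simple functions below it, which is monotone whether or not the
    functions are measurable. *)
Lemma ge0_le_integral_nonmeas (D : set T) (f g : T -> \bar R) :
  (forall w, D w -> 0 <= f w)%E -> (forall w, D w -> f w <= g w)%E ->
  (\int[P]_(w in D) f w <= \int[P]_(w in D) g w)%E.
Proof.
move=> f0 fg; rewrite !ge0_integralE//; last first.
  by move=> w Dw; exact: le_trans (f0 w Dw) (fg w Dw).
apply: le_ereal_sup => _ [k kf <-]; exists k => // w.
apply: (le_trans (kf w)); rewrite !patchE; case: ifPn => //.
by rewrite inE; exact: fg.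
Qed.

Lemma expectation_le_cst (Z : T -> R) (C : R) (N : set T) :
  measurable N -> P N = 0%E -> 0 <= C -> (forall w, ~ N w -> Z w <= C) ->
  ('E_P[Z] <= C%:E)%E.
Proof.
move=> mN PN C0 ZC; rewrite unlock integralE.
(* The bound is C off N and +oo on N, which integrates to C. *)
pose g : T -> \bar R := (fun w => C%:E + +oo * (\1_N w)%:E)%E.
have mN1 : measurable_fun setT (fun w => (\1_N w : R)%:E).
  by apply/measurable_EFinP; exact: measurable_indic.
have intg : (\int[P]_w g w = C%:E)%E.
  rewrite ge0_integralD//=; last exact: measurable_funeM.
  rewrite integral_cst//= probability_setT mule1.
  rewrite ge0_integralZl//.
  by rewrite integral_indic//= setIT PN mule0 adde0.
rewrite -intg.
apply: (@le_trans _ _ (\int[P]_w ((EFin \o Z)^\+ w))%E).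
  by rewrite -[leRHS]sube0 leeB// ?integral_ge0.
apply: ge0_le_integral_nonmeas => // w.
rewrite /g/= indicE; case: (boolP (w \in N)) => [_|/negP wN].
  by rewrite mule1 addey// leey.
rewrite mule0 adde0 funeposE ge_max !lee_fin C0 andbT ZC// => Nw.
by apply: wN; rewrite inE.
Qed.

Lemma expectation_ge_cst (Z : T -> R) (C : R) (A : set T) :
  measurable A -> 0 <= C -> (forall w, 0 <= Z w) ->
  (forall w, A w -> C <= Z w) -> (C%:E * P A <= 'E_P[Z])%E.
Proof.
move=> mA C0 Z0 ZC; rewrite unlock -(integral_cst _ mA) integral_mkcond.
apply: ge0_le_integral_nonmeas => w.
  by rewrite patchE; case: ifP => // _; rewrite lee_fin.
rewrite patchE; case: ifPn; rewrite ?inE => // Aw; rewrite lee_fin ?ZC//.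
Qed.

End Expectation.

(** * Upper limits of bounded sequences *)

Section LimSup.
Context {R : realType}.
Implicit Types u : nat -> R.

Lemma range_bounded_fun u (C : R) :
  (forall n, 0 <= u n <= C) -> bounded_fun u.
Proof.
move=> uC; exists C; split; first exact: num_real.
move=> K CK n _ /=; rewrite ger0_norm; last by case/andP: (uC n).
by rewrite ltW// (le_lt_trans _ CK)//; case/andP: (uC n).
Qed.

Lemma has_sup_sdrop u (C : R) n :
  (forall n, 0 <= u n <= C) -> has_sup (sdrop u n).
Proof.
move=> uC; split; first by exists (u n), n => /=.
by exists C => _ [m _ <-]; case/andP: (uC m).
Qed.

Lemma limn_sup_ge0 u (C : R) :
  (forall n, 0 <= u n <= C) -> 0 <= limn_sup u.
Proof.
move=> uC; rewrite limn_supE; last exact: range_bounded_fun uC.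
apply: lb_le_inf; first by exists (sups u 0%N), 0%N.
move=> _ [n _ <-]; rewrite /sups/=.
apply: (@le_trans _ _ (u n)); first by case/andP: (uC n).
by apply: sup_upper_bound; [exact: has_sup_sdrop uC|exists n => /=].
Qed.

Lemma limn_sup_le_eventually u (K C : R) n :
  (forall m, 0 <= u m <= K) -> (forall m, (n <= m)%N -> u m <= C) ->
  limn_sup u <= C.
Proof.
move=> uK uC; rewrite limn_supE; last exact: range_bounded_fun uK.
apply: (@le_trans _ _ (sups u n)).
  apply: ge_inf; last by exists n.
  by apply: bounded_fun_has_lbound_sups; exact: range_bounded_fun uK.
apply: ge_sup; first by exists (u n), n => /=.
by move=> _ [m nm <-]; exact: uC.
Qed.

End LimSup.

(** * Markov chains on path space *)

Section MarkovChain.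
Context {X : pointedType} {R : realType}.
Implicit Types (x y : X) (t n : nat) (B : set X) (A : set (pathspace X)).

Lemma filtration_coordinate s t B : (s <= t)%N ->
  natural_filtration t [set w : pathspace X | B (w s)].
Proof. by move=> st; apply: sub_sigma_algebra; exists s, B. Qed.

Lemma filtration_setI t A A' :
  natural_filtration t A -> natural_filtration t A' ->
  natural_filtration t (A `&` A').
Proof.
exact: (@measurableI _ (g_sigma_algebraType (cylinders [set s | (s <= t)%N]))).
Qed.

Lemma filtration_bigcap t (A : nat -> set (pathspace X)) :
  (forall n, natural_filtration t (A n)) ->
  natural_filtration t (\bigcap_n A n).
Proof.
move=> FA.
exact: (@bigcapT_measurable _
  (g_sigma_algebraType (cylinders [set s | (s <= t)%N]))).
Qed.

Lemma filtration_measurable t A : natural_filtration t A -> measurable A.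
Proof.
by apply: sub_sigma_algebra2 => _ [s [B [_ ->]]]; exists s, B.
Qed.

Lemma measurable_coordinate t B :
  measurable [set w : pathspace X | B (w t)].
Proof. exact: filtration_measurable (filtration_coordinate B (leqnn t)). Qed.

Lemma filtration_start_step x y :
  natural_filtration 1 [set w : pathspace X | w 0%N = x /\ w 1%N = y].
Proof.
apply: (@filtration_setI _ [set w | w 0%N = x] [set w | w 1%N = y]).
  exact: (filtration_coordinate [set x]).
exact: (filtration_coordinate [set y]).
Qed.

Variable P : X -> probability (pathspace X) R.
Hypothesis markovP : markov_chain P.

Lemma start_ae x : P x [set w : pathspace X | w 0%N <> x] = 0%E.
Proof.
have m0 : measurable [set w : pathspace X | w 0%N = x].
  exact: (measurable_coordinate 0 [set x]).
rewrite (_ : [set _ | _] = ~` [set w : pathspace X | w 0%N = x])//.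
by rewrite probability_setC// markovP.1 subee.
Qed.

(** The defining identity of the conditional probability of the event
    that X_(t+1) lies in B, integrated over A in F_t. *)
Lemma markov_integral x t B A : natural_filtration t A ->
  (\int[P x]_(w in A)
     (fine (P (w t) [set w' : pathspace X | B (w' 1%N)]))%:E =
   P x (A `&` [set w : pathspace X | B (w t.+1)]))%E.
Proof.
move=> FA; have [_ _ ->//] := markovP.2 x t B.
have mB : measurable [set w : pathspace X | B (w t.+1)].
  exact: measurable_coordinate.
by rewrite (integral_indic (P x) (filtration_measurable FA) mB) setIC.
Qed.

Lemma markov_step_ge x t B A (r : R) : natural_filtration t A -> 0 <= r ->
  (forall w, A w -> r%:E <= P (w t) [set w' : pathspace X | B (w' 1%N)])%E ->
  (r%:E * P x A <= P x (A `&` [set w : pathspace X | B (w t.+1)]))%E.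
Proof.
move=> FA r0 rP; rewrite -markov_integral//.
rewrite -(integral_cst _ (filtration_measurable FA)).
apply: ge0_le_integral_nonmeas => w Aw //=.
rewrite fineK ?rP// fin_num_measure//; exact: measurable_coordinate.
Qed.

Lemma markov_step_null x t B A : natural_filtration t A ->
  (forall w, A w -> P (w t) [set w' : pathspace X | B (w' 1%N)] = 0%E) ->
  P x (A `&` [set w : pathspace X | B (w t.+1)]) = 0%E.
Proof.
move=> FA P0; rewrite -markov_integral//; apply: integral0_eq => w Aw.
by rewrite P0.
Qed.

Lemma measurable_transition a c :
  measurable [set w : pathspace X | exists t, w t = a /\ w t.+1 = c].
Proof.
rewrite (_ : [set _ | _] = \bigcup_t
    ([set w | w t = a] `&` [set w : pathspace X | w t.+1 = c])); last first.
  by apply/seteqP; split=> [w [t]|w [t _]]; exists t.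
apply: bigcupT_measurable => t; apply: measurableI.
  exact: (measurable_coordinate t [set a]).
exact: (measurable_coordinate t.+1 [set c]).
Qed.

(** A jump of probability zero almost surely never occurs. *)
Lemma forbidden_transition_ae x a c :
  P a [set w : pathspace X | w 1%N = c] = 0%E ->
  P x [set w : pathspace X | exists t, w t = a /\ w t.+1 = c] = 0%E.
Proof.
move=> Pac.
pose N t := [set w : pathspace X | w t = a] `&` [set w | w t.+1 = c].
have FN t : natural_filtration t.+1 (N t).
  apply: filtration_setI; first exact: (filtration_coordinate [set a]).
  exact: (filtration_coordinate [set c]).
have mN t : measurable (N t) by exact: filtration_measurable (FN t).
rewrite (_ : [set _ | _] = \bigcup_t N t); last first.
  by apply/seteqP; split=> [w [t]|w [t _]]; exists t.
apply/negligibleP; first exact: bigcupT_measurable.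
apply: negligible_bigcup => t; apply/negligibleP => //.
apply: (markov_step_null x (B := [set c])) => [|w /= ->]//.
exact: (filtration_coordinate [set a]).
Qed.

(** The event that the chain does not visit c at the times 1, ..., n; the
    initial state is not constrained. *)
Definition avoids c n : set (pathspace X) :=
  [set w | forall t, (0 < t <= n)%N -> w t <> c].

Lemma avoids_filtration c n : natural_filtration n (avoids c n).
Proof.
rewrite (_ : avoids c n = \bigcap_t
    [set w | (0 < t <= n)%N -> w t <> c]); last first.
  by apply/seteqP; split=> [w wc t _|w wc t]; exact: wc.
apply: filtration_bigcap => t; have [tn|tn] := boolP (0 < t <= n)%N.
  rewrite (_ : [set _ | _] = [set w : pathspace X | (~` [set c]) (w t)]).
    by apply: filtration_coordinate; case/andP: tn.
  by apply/seteqP; split=> w /=; [exact|].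
rewrite (_ : [set _ | _] = [set w : pathspace X | setT (w 0%N)]).
  exact: filtration_coordinate.
by apply/seteqP; split.
Qed.

Lemma measurable_avoids_forever c :
  measurable [set w : pathspace X | forall t, (0 < t)%N -> w t <> c].
Proof.
rewrite (_ : [set _ | _] = \bigcap_n avoids c n).
  apply: bigcapT_measurable => n.
  exact: filtration_measurable (@avoids_filtration c n).
apply/seteqP; split=> [w wc n _ t /andP[t0 _]|w wc t t0]; first exact: wc.
by apply: (wc t) => //; rewrite t0/=.
Qed.

(** If c is reached from b with positive probability, and b from every state
    other than b and c with a probability bounded below, then c is almost surely
    visited. Write s_n for the probability of [avoids c n] and split it as
    u_n + v_n, according to whether X_n = b or not. Then
    s_(n+1) + q u_n <= s_n and, for n >= 1, r v_n <= u_(n+1) (at time 0 the chain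
    may be in c), so r s_n + s_(n+1) decreases at each step by at least q r p,
    with p the probability of never visiting c; as it is nonnegative, p = 0. *)
Lemma avoids_forever_ae x b c (q r : R) : b <> c -> 0 < q -> 0 < r ->
  (q%:E <= P b [set w : pathspace X | w 1%N = c])%E ->
  (forall y, y <> b -> y <> c ->
    r%:E <= P y [set w : pathspace X | w 1%N = b])%E ->
  P x [set w : pathspace X | forall t, (0 < t)%N -> w t <> c] = 0%E.
Proof.
move=> bc q0 r0 qP rP; set N := [set _ | _].
have mN : measurable N by exact: measurable_avoids_forever.
pose Ab n := avoids c n `&` [set w | w n = b].
pose Ao n := avoids c n `&` [set w | w n <> b].
have FAb n : natural_filtration n (Ab n).
  apply: filtration_setI; first exact: avoids_filtration.
  exact: (filtration_coordinate [set b]).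
have FAo n : natural_filtration n (Ao n).
  apply: filtration_setI; first exact: avoids_filtration.
  exact: (filtration_coordinate (~` [set b])).
have mA n : measurable (avoids c n).
  exact: filtration_measurable (@avoids_filtration c n).
have mAb n : measurable (Ab n) := filtration_measurable (FAb n).
have mAo n : measurable (Ao n) := filtration_measurable (FAo n).
pose s n := fine (P x (avoids c n)).
pose u n := fine (P x (Ab n)).
pose v n := fine (P x (Ao n)).
have PA n : P x (avoids c n) = (s n)%:E by rewrite fineK// fin_num_measure.
have PAb n : P x (Ab n) = (u n)%:E by rewrite fineK// fin_num_measure.
have PAo n : P x (Ao n) = (v n)%:E by rewrite fineK// fin_num_measure.
have suv n : s n = u n + v n.
  apply/EFin_inj; rewrite EFinD -PA -PAb -PAo -measureU//.
    rewrite -setIUr (_ : _ `|` _ = setT) ?setIT//.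
    by apply/seteqP; split=> // w _; exact: EM.
  by apply/seteqP; split=> // w [[_ wb] [_]].
have loss n : s n.+1 + q * u n <= s n.
  have mc : measurable [set w : pathspace X | w n.+1 = c].
    exact: (measurable_coordinate n.+1 [set c]).
  rewrite -lee_fin EFinD EFinM -!PA -PAb.
  have qn : (q%:E * P x (Ab n) <=
      P x (Ab n `&` [set w : pathspace X | w n.+1 = c]))%E.
    by apply: (markov_step_ge x (B := [set c])) (FAb n) (ltW q0) _ => w [_ ->].
  apply: (le_trans (leeD2l _ qn)); rewrite -measureU//.
  - apply: le_measure; rewrite ?inE//.
    + by apply: measurableU => //; exact: measurableI.
    + move=> w [wc t /andP[t0 tn]|[[]]//]; apply: wc.
      by rewrite t0 (leq_trans tn).
  - exact: measurableI.
  - by apply/seteqP; split=> // w [/(_ n.+1) wc [_ /wc]];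
      rewrite ltnS leqnn; exact.
have back n : r * v n.+1 <= u n.+2.
  rewrite -lee_fin EFinM -PAb -PAo.
  have rn : (r%:E * P x (Ao n.+1) <=
      P x (Ao n.+1 `&` [set w : pathspace X | w n.+2 = b]))%E.
    apply: (markov_step_ge x (B := [set b])) (FAo n.+1) (ltW r0) _ => w [wc wb].
    by apply: rP => //; apply: wc; rewrite ltnS leqnn.
  apply: (le_trans rn); apply: le_measure; rewrite ?inE//.
    apply: measurableI => //; exact: (measurable_coordinate n.+2 [set b]).
  move=> w [[wc _] /= wb]; split=> // t /andP[t0].
  rewrite leq_eqVlt ltnS => /predU1P[->|tn]; first by rewrite wb.
  by apply: wc; rewrite t0.
pose p := fine (P x N).
have PN : P x N = p%:E by rewrite fineK// fin_num_measure.
have p0 : 0 <= p by exact: fine_ge0.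
have ps n : p <= s n.
  rewrite -lee_fin -PA -PN; apply: le_measure; rewrite ?inE//.
  by move=> w wc t /andP[t0 _]; exact: wc.
have s0 n : 0 <= s n by exact: le_trans (ps n).
pose phi n := r * s n.+1 + s n.+2.
have decr n : phi n.+1 <= phi n - q * r * p.
  have h1 : r * (s n.+2 + q * u n.+1) <= r * s n.+1 by rewrite ler_pM2l.
  have h2 : q * (r * v n.+1) <= q * u n.+2 by rewrite ler_pM2l.
  have h3 : q * r * p <= q * r * (u n.+1 + v n.+1).
    by rewrite -suv ler_wpM2l// mulr_ge0// ltW.
  by rewrite /phi; have := loss n.+2; nra.
have bound n : 0 <= phi 0%N - n%:R * (q * r * p).
  apply: (@le_trans _ _ (phi n)).
    by rewrite addr_ge0// mulr_ge0// ltW.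
  elim: n => [|n IHn]; first by rewrite mul0r subr0.
  by rewrite (le_trans (decr n))// -natr1 mulrDl mul1r opprD addrA lerB.
rewrite PN; congr EFin; apply/eqP; move: p0; rewrite le_eqVlt eq_sym.
case/orP => // p0; exfalso.
have e0 : 0 < q * r * p by rewrite !mulr_gt0.
have := archi_boundP (divr_ge0 (bound 0%N) (ltW e0)).
rewrite mul0r subr0 ltr_pdivrMr// ltNge => /negP; apply.
by rewrite -subr_ge0; exact: bound.
Qed.

(** The one-step transition probability P_x(X_1 = y), as a real number. *)
Definition transition x y : R :=
  fine (P x [set w : pathspace X | w 1%N = y]).

Lemma transitionE x y :
  P x [set w : pathspace X | w 1%N = y] = (transition x y)%:E.
Proof.
by rewrite fineK// fin_num_measure//; exact: (measurable_coordinate 1 [set y]).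
Qed.

Lemma transition_ge0 x y : 0 <= transition x y.
Proof. exact: fine_ge0. Qed.

Lemma start_step_ge x y :
  ((transition x y)%:E <= P x [set w : pathspace X | w 0%N = x /\ w 1%N = y])%E.
Proof.
rewrite -[leLHS]mule1 -(markovP.1 x).
apply: (markov_step_ge x (B := [set y])) => [||w /= ->].
- exact: (filtration_coordinate [set x]).
- exact: transition_ge0.
- by rewrite transitionE.
Qed.

Lemma start_two_steps_ge x y z :
  ((transition x y * transition y z)%:E <=
   P x [set w : pathspace X | (w 0%N = x /\ w 1%N = y) /\ w 2%N = z])%E.
Proof.
rewrite mulrC EFinM.
apply: (le_trans (lee_wpmul2l _ (start_step_ge x y))).
  by rewrite lee_fin transition_ge0.
apply: (markov_step_ge x (B := [set z])) => [||w /= [_ ->]].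
- exact: filtration_start_step.
- exact: transition_ge0.
- by rewrite transitionE.
Qed.

End MarkovChain.

(** * First hitting times *)

Section FirstTime.
Implicit Types (A : pred nat) (k n : nat).

Lemma inf_timeP A :
  match inf_time A with
  | Some n => A n /\ forall m, A m -> (n <= m)%N
  | None => forall n, ~~ A n
  end.
Proof.
rewrite /inf_time; case: pselect => [exA|nexA].
  by case: ex_minnP => n An min_n; split.
by move=> n; apply/negP => An; apply: nexA; exists n.
Qed.

Lemma inf_time_first A k : A k -> (forall r, (r < k)%N -> ~~ A r) ->
  inf_time A = Some k.
Proof.
move=> Ak nA; have := inf_timeP A.
case: inf_time => [n [An min_n]|/(_ k)]; last by rewrite Ak.
congr Some; apply/eqP; rewrite eqn_leq min_n//= leqNgt.
by apply/negP => /nA; rewrite An.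
Qed.

Lemma inf_time_none A : (forall n, ~~ A n) -> inf_time A = None.
Proof.
move=> nA; have := inf_timeP A.
by case: inf_time => // n [An _]; have := nA n; rewrite An.
Qed.

Lemma inf_time_after A k : (forall r, (r <= k)%N -> ~~ A r) ->
  if inf_time A is Some n then (k < n)%N else true.
Proof.
move=> nA; have := inf_timeP A; case: inf_time => // n [An _].
by rewrite ltnNge; apply/negP => /nA; rewrite An.
Qed.

End FirstTime.

(** * Payoffs and intra-personal equilibria in a Dynkin game *)

Section Game.
Context {X : pointedType} {R : realType}.
Implicit Types (x y z : X) (S T : set X) (w : pathspace X) (k r s t : nat).
Variables (delta : nat -> R) (f g h : X -> R) (K : R).
Hypothesis disc : discount_function delta.
Hypothesis f0 : forall x, 0 <= f x.
Hypothesis g0 : forall x, 0 <= g x.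
(* The bound on h keeps the upper limit that defines the payoff of an endless
   game finite. *)
Hypothesis h0 : forall x, 0 <= h x <= K.

Let payoff := F delta f g h.

Lemma discount_ge0 t : 0 <= delta t.
Proof. by case: disc => /(_ t)/andP[]. Qed.

Lemma discount_gt0 t : 0 < delta t.
Proof.
case: disc => _ _ decr _.
by rewrite (le_lt_trans (discount_ge0 t.+1))// decr.
Qed.

Lemma discount_le1 t : delta t <= 1.
Proof. by case: disc => /(_ t)/andP[]. Qed.

Lemma discount_nonincreasing s t : (s <= t)%N -> delta t <= delta s.
Proof.
case: disc => _ _ decr _.
by rewrite leq_eqVlt => /predU1P[->//|/decr /ltW].
Qed.

Lemma discounted_bounded t w : 0 <= delta t * h (w t) <= K.
Proof.
have /andP[hw0 hwK] := h0 (w t); rewrite mulr_ge0 ?discount_ge0//=.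
by rewrite (le_trans _ hwK)// ler_piMl// discount_le1.
Qed.

Lemma payoff_ge0 (tau sigma : pathspace X -> option nat) w :
  0 <= payoff tau sigma w.
Proof.
have h0' x : 0 <= h x by case/andP: (h0 x).
rewrite /payoff /F; case: (tau w) (sigma w) => [s|] [t|].
- by case: ifP => _; [|case: ifP => _]; rewrite mulr_ge0// discount_ge0.
- by rewrite mulr_ge0// discount_ge0.
- by rewrite mulr_ge0// discount_ge0.
- by apply: (@limn_sup_ge0 _ _ K) => t; exact: discounted_bounded.
Qed.

Lemma payoff_stop S w : payoff (fun=> Some 0%N) (rho S) w =
  if w 0%N \in S then h (w 0%N) else f (w 0%N).
Proof.
have d0 : delta 0%N = 1 by case: disc.
rewrite /payoff /F /rho; case: ifPn => w0.
  by rewrite (@inf_time_first _ 0%N)//= d0 mul1r.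
have := @inf_time_after (fun t => w t \in S) 0%N.
case: inf_time => [t ->|_]; rewrite ?d0 ?mul1r//.
by move=> r; rewrite leqn0 => /eqP ->.
Qed.

Lemma payoff_continue_first_own S T w k : (0 < k)%N -> S (w k) ->
  (forall r, (0 < r < k)%N -> ~ S (w r)) ->
  (forall r, (r <= k)%N -> ~ T (w r)) ->
  payoff (rho_plus S) (rho T) w = delta k * f (w k).
Proof.
move=> k0 Sk nS nT; rewrite /payoff /F /rho_plus (@inf_time_first _ k).
- have := @inf_time_after (fun t => w t \in T) k; rewrite -/(rho T w).
  case: (rho T w) => // t -> // r rk.
  by apply/negP; rewrite inE; exact: nT.
- by rewrite k0 inE.
- move=> r rk; apply/negP => /andP[r0]; rewrite inE.
  by apply: nS; rewrite r0.
Qed.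

Lemma payoff_continue_first_other S T w k : T (w k) ->
  (forall r, (r < k)%N -> ~ T (w r)) ->
  (forall r, (0 < r <= k)%N -> ~ S (w r)) ->
  payoff (rho_plus S) (rho T) w = delta k * g (w k).
Proof.
move=> Tk nT nS; rewrite /payoff /F /rho (@inf_time_first _ k).
- have := @inf_time_after (fun t => (0 < t)%N && (w t \in S)) k.
  rewrite -/(rho_plus S w); case: (rho_plus S w) => // t kt.
  have {}kt : (k < t)%N.
    apply: kt => r rk; apply/negP => /andP[r0]; rewrite inE.
    by apply: nS; rewrite r0.
  by rewrite ltnNge (ltnW kt)/= kt.
- by rewrite inE.
- by move=> r rk; apply/negP; rewrite inE; exact: nT.
Qed.

Lemma payoff_continue_never S T w : (forall r, (0 < r)%N -> ~ S (w r)) ->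
  (forall r, ~ T (w r)) ->
  payoff (rho_plus S) (rho T) w = limn_sup (fun t => delta t * h (w t)).
Proof.
move=> nS nT; rewrite /payoff /F /rho_plus /rho !inf_time_none// => r.
  by apply/negP; rewrite inE; exact: nT.
by apply/negP => /andP[r0]; rewrite inE; exact: nS.
Qed.

(** Upper bound on the payoff of continuing along a path: it suffices to bound
    what is received at the first time the path meets S or T and, if it meets
    neither, what h gives along the path. *)
Lemma payoff_continue_le S T w (C : R) :
  (forall x, S x -> ~ T x) -> ~ T (w 0%N) ->
  (forall s, (0 < s)%N -> (forall r, (0 < r < s)%N -> ~ S (w r) /\ ~ T (w r)) ->
    (S (w s) -> delta s * f (w s) <= C) /\
    (T (w s) -> delta s * g (w s) <= C)) ->
  ((forall s, (0 < s)%N -> ~ S (w s) /\ ~ T (w s)) ->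
    forall s, (0 < s)%N -> delta s * h (w s) <= C) ->
  payoff (rho_plus S) (rho T) w <= C.
Proof.
move=> disj nT0 stopped never.
have nT r k : (forall r, (0 < r < k)%N -> ~ S (w r) /\ ~ T (w r)) ->
    (r < k)%N -> ~ T (w r).
  by case: r => // r before rk; apply: (before r.+1 _).2.
have := inf_timeP (fun t => (0 < t)%N && ((w t \in S) || (w t \in T))).
case: inf_time => [k [/andP[k0 hit] min_k]|never_hit].
  have before r : (0 < r < k)%N -> ~ S (w r) /\ ~ T (w r).
    move=> /andP[r0]; rewrite ltnNge => rk.
    by split=> hr; move: rk => /negP; apply; apply: min_k;
      rewrite r0/= (mem_set hr) ?orbT.
  have [onS onT] := stopped k k0 before.
  case/orP: hit => [/set_mem Sk|/set_mem Tk].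
    rewrite (@payoff_continue_first_own _ _ _ k)//; first exact: onS.
      by move=> r /before[].
    move=> r; rewrite leq_eqVlt => /predU1P[->|]; first exact: disj.
    exact: nT.
  rewrite (@payoff_continue_first_other _ _ _ k)//; first exact: onT.
    by move=> r; exact: nT.
  move=> r /andP[r0]; rewrite leq_eqVlt => /predU1P[->/disj//|rk].
  by apply: (before r _).1; rewrite r0.
have {}never_hit r : (0 < r)%N -> ~ S (w r) /\ ~ T (w r).
  move=> r0; have /negP := never_hit r; rewrite r0/= => nST.
  by split=> hr; apply: nST; rewrite (mem_set hr) ?orbT.
rewrite payoff_continue_never.
- apply: (@limn_sup_le_eventually _ _ K _ 1%N) => t.
    exact: discounted_bounded.
  exact: never.
- by move=> r /never_hit[].
- by case=> // r; apply: (never_hit r.+1 _).2.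
Qed.

Variable P : X -> probability (pathspace X) R.
Hypothesis markovP : markov_chain P.

Let value := J P delta f g h.
Let equilibrium := intra_equilibrium P delta f g h.

Lemma value_ge x (tau sigma : pathspace X -> option nat) (A : set (pathspace X))
    (C p : R) :
  measurable A -> (p%:E <= P x A)%E -> 0 <= C ->
  (forall w, A w -> C <= payoff tau sigma w) ->
  ((C * p)%:E <= value x tau sigma)%E.
Proof.
move=> mA pA C0 CF; rewrite EFinM.
apply: (@le_trans _ _ (C%:E * P x A)%E).
  by apply: lee_wpmul2l => //; rewrite lee_fin.
by apply: expectation_ge_cst => // w; exact: payoff_ge0.
Qed.

Lemma value_le x (tau sigma : pathspace X -> option nat) (N : set (pathspace X))
    (C : R) :
  measurable N -> P x N = 0%E -> 0 <= C ->
  (forall w, w 0%N = x -> ~ N w -> payoff tau sigma w <= C) ->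
  (value x tau sigma <= C%:E)%E.
Proof.
move=> mN PN C0 FC.
have m0 : measurable [set w : pathspace X | w 0%N <> x].
  exact: (measurable_coordinate 0 (~` [set x])).
apply: (@expectation_le_cst _ _ _ _ _ _ (N `|` [set w | w 0%N <> x])).
- exact: measurableU.
- by apply: null_set_setU => //; exact: start_ae.
- by [].
- move=> w /not_orP[Nw /contrapT wx]; exact: FC.
Qed.

Lemma value_stop_le S x :
  (value x (fun=> Some 0%N) (rho S) <= (if x \in S then h x else f x)%:E)%E.
Proof.
apply: (@value_le _ _ _ set0) => //.
  by case: ifP => // _; case/andP: (h0 x).
by move=> w wx _; rewrite payoff_stop wx.
Qed.

Lemma value_stop_ge S x :
  ((if x \in S then h x else f x)%:E <= value x (fun=> Some 0%N) (rho S))%E.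
Proof.
rewrite -[X in X%:E]mulr1.
apply: (@value_ge _ _ _ [set w | w 0%N = x]) => [||| w /= wx].
- exact: (measurable_coordinate 0 [set x]).
- by rewrite markovP.1.
- by case: ifP => // _; case/andP: (h0 x).
- by rewrite payoff_stop wx.
Qed.

Lemma equilibrium_continue_le S T x : equilibrium T S -> S x ->
  (value x (rho_plus S) (rho T) <= (if x \in T then h x else f x)%:E)%E.
Proof.
move=> eqS Sx; have : Theta P delta f g h T S x by rewrite eqS.
by case=> -[//] _ le_stop; exact: le_trans le_stop (value_stop_le T x).
Qed.

Lemma equilibrium_continue_ge S T x : equilibrium T S -> ~ S x ->
  ((if x \in T then h x else f x)%:E <= value x (rho_plus S) (rho T))%E.
Proof.
move=> eqS nSx; apply: (le_trans (value_stop_ge T x)).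
rewrite leNgt; apply/negP => gt_stop; apply: (nSx).
by rewrite -eqS; right; split.
Qed.

(** Where the opponent stops, waiting yields g at time 0 instead of h, so
    stopping as well is not optimal. *)
Lemma equilibria_disjoint S T : (forall x, h x < g x) -> equilibrium T S ->
  forall x, S x -> ~ T x.
Proof.
move=> hg eqS x Sx Tx; have := equilibrium_continue_le eqS Sx.
rewrite (mem_set Tx) leNgt => /negP; apply.
apply: (@lt_le_trans _ _ (g x)%:E); first by rewrite lte_fin.
rewrite -[g x]mulr1.
apply: (@value_ge _ _ _ [set w | w 0%N = x]) => [||| w /= wx] //.
- exact: (measurable_coordinate 0 [set x]).
- by rewrite markovP.1.
have d0 : delta 0%N = 1 by case: disc.
rewrite (@payoff_continue_first_other _ _ _ 0%N) ?wx ?d0 ?mul1r//.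
by move=> r; rewrite leqn0 => /andP[r0 /eqP re]; rewrite re in r0.
Qed.

(** At a state x of S outside T, the value of continuing is at most f x, while
    it is at least the part of it collected on the paths that go from x to y
    (and then to z). *)

Section Stopping.
Variables (S T : set X) (x y : X).
Hypotheses (eqS : equilibrium T S) (Sx : S x) (nTx : ~ T x).

Let continue_le : (value x (rho_plus S) (rho T) <= (f x)%:E)%E.
Proof.
by have := equilibrium_continue_le eqS Sx; rewrite memNset.
Qed.

Lemma equilibrium_own_step : S y -> ~ T y ->
  delta 1%N * f y * transition P x y <= f x.
Proof.
move=> Sy nTy; rewrite -lee_fin; apply: le_trans continue_le.
apply: (value_ge _ (start_step_ge markovP x y)).
- exact: filtration_measurable (filtration_start_step x y).
- by rewrite mulr_ge0// discount_ge0.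
- move=> w /= [w0 w1]; rewrite (@payoff_continue_first_own _ _ _ 1%N) ?w1//.
    by move=> [|[|]].
  by move=> [|[|]]//; rewrite ?w0 ?w1.
Qed.

Lemma equilibrium_other_step : T y -> ~ S y ->
  delta 1%N * g y * transition P x y <= f x.
Proof.
move=> Ty nSy; rewrite -lee_fin; apply: le_trans continue_le.
apply: (value_ge _ (start_step_ge markovP x y)).
- exact: filtration_measurable (filtration_start_step x y).
- by rewrite mulr_ge0// discount_ge0.
- move=> w /= [w0 w1]; rewrite (@payoff_continue_first_other _ _ _ 1%N) ?w1//.
    by move=> [|[|]]//; rewrite ?w0.
  by move=> [|[|]]//; rewrite ?w1.
Qed.

Lemma equilibrium_own_two_steps z : ~ S y -> ~ T y -> S z -> ~ T z ->
  delta 2%N * f z * (transition P x y * transition P y z) <= f x.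
Proof.
move=> nSy nTy Sz nTz; rewrite -lee_fin; apply: le_trans continue_le.
apply: (value_ge _ (start_two_steps_ge markovP x y z)).
- apply: (@measurableI _ _ [set w : pathspace X | w 0%N = x /\ w 1%N = y]).
    exact: filtration_measurable (filtration_start_step x y).
  exact: (measurable_coordinate 2 [set z]).
- by rewrite mulr_ge0// discount_ge0.
- move=> w /= [[w0 w1] w2].
  rewrite (@payoff_continue_first_own _ _ _ 2%N) ?w2//.
    by move=> [|[|[|]]]//; rewrite ?w1.
  by move=> [|[|[|]]]//; rewrite ?w0 ?w1 ?w2.
Qed.

End Stopping.

(** At a state x outside S and T, stopping is worth f x and continuing is at
    least as good, so any almost sure bound on the payoff of continuing bounds
    f x. *)
Lemma equilibrium_not_stopping S T x (N : set (pathspace X)) (C : R) :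
  equilibrium T S -> (forall x, S x -> ~ T x) -> ~ S x -> ~ T x ->
  measurable N -> P x N = 0%E -> 0 <= C ->
  (forall w, w 0%N = x -> ~ N w ->
    (forall s, (0 < s)%N ->
      (forall r, (0 < r < s)%N -> ~ S (w r) /\ ~ T (w r)) ->
      (S (w s) -> delta s * f (w s) <= C) /\
      (T (w s) -> delta s * g (w s) <= C)) /\
    ((forall s, (0 < s)%N -> ~ S (w s) /\ ~ T (w s)) ->
      forall s, (0 < s)%N -> delta s * h (w s) <= C)) ->
  f x <= C.
Proof.
move=> eqS disj nSx nTx mN PN C0 wC; rewrite -lee_fin.
have := equilibrium_continue_ge eqS nSx; rewrite memNset// => /le_trans; apply.
apply: (value_le mN) => // w wx /(wC w wx)[stopped never].
by apply: payoff_continue_le => //; rewrite wx.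
Qed.

End Game.

(** * Violation of the supermartingale condition *)

Lemma supermartingale_step_le (X : pointedType) (R : realType)
    (P : X -> probability (pathspace X) R) (delta : nat -> R) (g : X -> R)
    (x y : X) :
  markov_chain P -> (forall t, 0 <= delta t) -> (forall z, 0 <= g z) ->
  supermartingale (P x) (@natural_filtration X)
    (fun t w => delta t * g (w t)) ->
  delta 1%N * g y * transition P x y <= delta 0%N * g x.
Proof.
move=> markovP d0 g0 /(_ 0%N)[_ _ [Z [_ _ eqZ] [N [mN PN ZN]]]].
have F0 : natural_filtration 0 [set: pathspace X].
  exact: (filtration_coordinate setT (leqnn 0)).
rewrite -lee_fin.
apply: (@le_trans _ _ ('E_(P x)[(fun w => delta 1%N * g (w 1%N))%R])%E).
  rewrite EFinM -transitionE.
  apply: expectation_ge_cst => [|||w /= ->]//.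
  - exact: (measurable_coordinate 1 [set y]).
  - by rewrite mulr_ge0.
  - by move=> w; rewrite mulr_ge0.
rewrite unlock -eqZ//.
have -> : (\int[P x]_w (Z w)%:E = 'E_(P x)[Z])%E by rewrite unlock.
have m0 : measurable [set w : pathspace X | w 0%N <> x].
  exact: (measurable_coordinate 0 (~` [set x])).
have PN' : P x (N `|` [set w | w 0%N <> x]) = 0%E.
  by apply: null_set_setU => //; exact: start_ae.
apply: (expectation_le_cst (measurableU _ _ mN m0) PN').
  by rewrite mulr_ge0.
move=> w /not_orP[Nw /contrapT wx]; apply: contrapT => nle; apply: Nw.
by apply: ZN => /= le; apply: nle; rewrite -wx.
Qed.

(** * The three-state game *)

Lemma eventually_large (R : realType) (s : seq R) : all (fun e => 0 < e) s ->
  exists2 M0 : R, 0 < M0 &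
    forall M, M0 <= M -> all (fun e => 3 < e * M) s.
Proof.
elim: s => [_|e s IHs /= /andP[e0 /IHs[M0 M00 M0P]]]; first by exists 1.
have e30 : 0 < 4 / e by rewrite divr_gt0.
exists (4 / e + M0) => [|M leM]; first exact: addr_gt0.
rewrite M0P ?andbT; last by rewrite (le_trans _ leM)// lerDr ltW.
rewrite mulrC -ltr_pdivrMr//; apply: (@lt_le_trans _ _ (4 / e)).
  by rewrite ltr_pM2r ?invr_gt0// ltr_nat.
by rewrite (le_trans _ leM)// lerDl ltW.
Qed.

Section Payoffs.
Context {R : realType}.
Implicit Types (M : R) (i : player) (x : state).

Lemma payoff_f_bound M i x : 3 < M -> 0 <= payoff_f M i x <= M ^+ 2 + 1.
Proof. by move=> M3; case: i; case: x => /=; apply/andP; split; nra. Qed.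

Lemma payoff_g_bound M i x : 3 < M -> 0 <= payoff_g M i x <= M ^+ 2 + 1.
Proof. by move=> M3; case: i; case: x => /=; apply/andP; split; nra. Qed.

Lemma payoff_h_bound M i x : 3 < M -> 0 <= payoff_h M i x <= M ^+ 2 + 1.
Proof.
move=> M3; rewrite /payoff_h; have /andP[f0 fM] := payoff_f_bound i x M3.
by have /andP[g0 gM] := payoff_g_bound i x M3; apply/andP; split; lra.
Qed.

Lemma payoff_h_lt_g M i x : 3 < M -> payoff_h M i x < payoff_g M i x.
Proof. by move=> M3; rewrite /payoff_h; case: i; case: x => /=; nra. Qed.

End Payoffs.

Section ThreeStates.
Context {R : realType}.
Variables (P : state -> probability (pathspace state) R)
  (delta : player -> nat -> R).
Hypothesis markovP : markov_chain P.
Hypothesis disc : forall i, discount_function (delta i).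
Hypothesis Pac : P sa [set w : pathspace state | w 1%N = sc] = 0%E.
Hypothesis Ppos : forall x y, (x, y) <> (sa, sc) ->
  (0 < P x [set w : pathspace state | w 1%N = y])%E.

Variable M : R.
Hypothesis M3 : 3 < M.

Let p := transition P.

Let f0 i x : 0 <= payoff_f M i x.
Proof. by case/andP: (payoff_f_bound i x M3). Qed.

Let g0 i x : 0 <= payoff_g M i x.
Proof. by case/andP: (payoff_g_bound i x M3). Qed.

Let hK i x := payoff_h_bound i x M3.

Lemma transition_gt0 x y : (x, y) <> (sa, sc) -> 0 < p x y.
Proof. by move=> /Ppos; rewrite transitionE lte_fin. Qed.

(** Every state other than b and c is a, and a leads to b, which leads to c. *)
Lemma never_c_ae x :
  P x [set w : pathspace state | forall t, (0 < t)%N -> w t <> sc] = 0%E.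
Proof.
apply: (avoids_forever_ae markovP x (b := sb) (q := p sb sc) (r := p sa sb)).
- by [].
- exact: transition_gt0.
- exact: transition_gt0.
- by rewrite transitionE.
- by case=> // _ _; rewrite transitionE.
Qed.

Section Equilibrium.
Variables S T : set state.
Hypothesis eqS : intra_equilibrium P (delta player1) (payoff_f M player1)
  (payoff_g M player1) (payoff_h M player1) T S.
Hypothesis eqT : intra_equilibrium P (delta player2) (payoff_f M player2)
  (payoff_g M player2) (payoff_h M player2) S T.

Lemma S_disjoint_T x : S x -> ~ T x.
Proof.
have hg y := payoff_h_lt_g player1 y M3.
exact: (equilibria_disjoint (disc player1) (f0 player1) (g0 player1)
  (hK player1) markovP hg eqS).
Qed.

Lemma T_disjoint_S x : T x -> ~ S x.
Proof. by move=> Tx /S_disjoint_T. Qed.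

Lemma player1_own_step x y : S x -> S y ->
  delta player1 1%N * payoff_f M player1 y * p x y <= payoff_f M player1 x.
Proof.
move=> Sx Sy.
exact: (equilibrium_own_step (disc player1) (f0 player1) (g0 player1)
  (hK player1) markovP eqS Sx (S_disjoint_T Sx) Sy (S_disjoint_T Sy)).
Qed.

Lemma player1_other_step x y : S x -> T y ->
  delta player1 1%N * payoff_g M player1 y * p x y <= payoff_f M player1 x.
Proof.
move=> Sx Ty.
exact: (equilibrium_other_step (disc player1) (f0 player1) (g0 player1)
  (hK player1) markovP eqS Sx (S_disjoint_T Sx) Ty (T_disjoint_S Ty)).
Qed.

Lemma player2_own_step x y : T x -> T y ->
  delta player2 1%N * payoff_f M player2 y * p x y <= payoff_f M player2 x.
Proof.
move=> Tx Ty.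
exact: (equilibrium_own_step (disc player2) (f0 player2) (g0 player2)
  (hK player2) markovP eqT Tx (T_disjoint_S Tx) Ty (T_disjoint_S Ty)).
Qed.

Lemma player2_own_two_steps x y z : T x -> ~ S y -> ~ T y -> T z ->
  delta player2 2%N * payoff_f M player2 z * (p x y * p y z) <=
  payoff_f M player2 x.
Proof.
move=> Tx nSy nTy Tz.
exact: (equilibrium_own_two_steps (disc player2) (f0 player2) (g0 player2)
  (hK player2) markovP eqT Tx (T_disjoint_S Tx) nTy nSy Tz (T_disjoint_S Tz)).
Qed.

(** Player 2 does not give up M^2 for a discounted M^2 + 1. *)
Lemma c_stopped : 3 < (1 - delta player2 1%N) * M -> S sc \/ T sc.
Proof.
move=> large; apply: contrapT => /not_orP[nS nT].
have dge t : (0 < t)%N -> delta player2 t <= delta player2 1%N.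
  exact: (discount_nonincreasing (disc player2)).
have d0 : 0 <= delta player2 1%N by exact: discount_ge0 (disc player2) _.
have leK t v : (0 < t)%N -> 0 <= v <= M ^+ 2 + 1 ->
    delta player2 t * v <= delta player2 1%N * (M ^+ 2 + 1).
  move=> t0 /andP[v0 vK]; apply: ler_pM => //; last exact: dge.
  exact: discount_ge0 (disc player2) _.
have : payoff_f M player2 sc <= delta player2 1%N * (M ^+ 2 + 1).
  apply: (equilibrium_not_stopping (disc player2) (f0 player2) (g0 player2)
    (hK player2) markovP eqT T_disjoint_S nT nS measurable0 (measure0 _)).
    by rewrite mulr_ge0// addr_ge0// sqr_ge0.
  move=> w _ _; split=> [s s0 _|_ s s0].
    split=> _; apply: leK => //; [exact: payoff_f_bound|exact: payoff_g_bound].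
  by apply: leK => //; exact: payoff_h_bound.
have M_gt3 := M3; have d1' := discount_le1 (disc player2) 1.
have : M * 3 < M * ((1 - delta player2 1%N) * M) by rewrite ltr_pM2l//; lra.
by move=> largeM /=; apply/negP; rewrite -ltNge; lra.
Qed.

(** If c is stopped, a is not in T and b is not stopped, then the game almost
    surely ends in a or c, with the first visit to c at the latest, and Player 1
    receives at most 2, less than the M offered at b. *)
Lemma b_stopped : ~ T sa -> S sc \/ T sc -> S sb \/ T sb.
Proof.
move=> nTa STc; apply: contrapT => /not_orP[nSb nTb].
have d0 t : 0 <= delta player1 t <= 1 by case: (disc player1).
suff : payoff_f M player1 sb <= 2.
  by have M_gt3 := M3; move=> /=; apply/negP; rewrite -ltNge; lra.
apply: (equilibrium_not_stopping (disc player1) (f0 player1) (g0 player1)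
  (hK player1) markovP eqS S_disjoint_T nSb nTb
  (measurable_avoids_forever sc) (never_c_ae sb)); first by [].
move=> w _ hits_c; split=> [s _ _|never].
  split; case: (w s) => // _ /=; have := d0 s; lra.
exfalso; apply: hits_c => t t0 wt.
by have := never t t0; rewrite wt; case: STc => [Sc []|Tc []].
Qed.

(** If b is in S, c in T and a not stopped, then from a the chain meets b before
    c, so Player 2 receives at most 2, or, if the chain never leaves a, at most
    delta_2(1) h_2(a); both are less than the M offered at a. *)
Lemma a_stopped : 3 < (1 - delta player2 1%N) * M -> S sb -> T sc ->
  S sa \/ T sa.
Proof.
move=> large Sb Tc; apply: contrapT => /not_orP[nSa nTa].
have d0 t : 0 <= delta player2 t <= 1 by case: (disc player2).
have dge t : (0 < t)%N -> delta player2 t <= delta player2 1%N.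
  exact: (discount_nonincreasing (disc player2)).
have d10 := d0 1%N.
have nTb := S_disjoint_T Sb; have nSc := T_disjoint_S Tc.
suff : payoff_f M player2 sa <= 2 + delta player2 1%N * (M + 1).
  by have M_gt3 := M3; move=> /=; apply/negP; rewrite -ltNge; lra.
have mN : measurable
    [set w : pathspace state | exists t, w t = sa /\ w t.+1 = sc].
  exact: measurable_transition.
apply: (equilibrium_not_stopping (disc player2) (f0 player2) (g0 player2)
  (hK player2) markovP eqT T_disjoint_S nTa nSa mN
  (forbidden_transition_ae markovP sa Pac)); first by have M_gt3 := M3; nra.
move=> w w0 no_ac; have stay_a x : ~ T x /\ ~ S x -> x = sa by case: x => -[].
split=> [s s0 before|never s s0].
  split=> hit.
    exfalso; apply: no_ac; exists s.-1; rewrite prednK//; split.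
      (* The state before the first visit to c is neither b nor c. *)
      case: s s0 before {hit} => // -[//|s] _ before.
      by apply/stay_a/before; rewrite /= leqnn.
    by move: hit; case: (w s).
  have -> : w s = sb by move: hit; case: (w s).
  by have M_gt3 := M3; have := d0 s; move=> /=; nra.
rewrite (stay_a _ (never s s0)) /payoff_h/=.
by have := d0 s; have := dge s s0; have M_gt3 := M3; nra.
Qed.

End Equilibrium.
End ThreeStates.

Theorem proposition4p1 (R : realType)
    (P : state -> probability (pathspace state) R)
    (delta : player -> nat -> R)
    (markovP : markov_chain P)
    (discount : forall i, discount_function (delta i))
    (Pac : P sa [set w : pathspace state | w 1%N = sc] = 0%E)
    (Ppos : forall x y, (x, y) <> (sa, sc) ->
      (0 < P x [set w : pathspace state | w 1%N = y])%E) :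
  exists M0 : R, 0 < M0 /\
    forall M : R, M0 <= M ->
      ~ (forall (i : player) (x : state),
           supermartingale (P x) (@natural_filtration state)
             (fun t (w : pathspace state) => delta i t * payoff_g M i (w t)))
      /\
      ~ (exists S T : set state,
           soft_inter_equilibrium P delta (payoff_f M) (payoff_g M)
             (payoff_h M) S T).
Proof.
have d10 := discount_gt0 (discount player1) 1.
have d20 := discount_gt0 (discount player2).
have d21 : 0 < 1 - delta player2 1%N.
  by case: (discount player2) => _ <- decr _; rewrite subr_gt0 decr.
have pos := transition_gt0 Ppos.
set p := transition P in pos.
have [|M0 M00 M0P] := @eventually_large R [:: 1; 1 - delta player2 1%N;
  delta player1 1%N * p sc sb; delta player1 1%N * p sc sa;
  delta player2 1%N * p sb sc; delta player1 1%N * p sb sa;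
  delta player1 1%N * p sa sb;
  delta player2 2%N * (p sa sb * p sb sc)].
  by rewrite /= ltr01 d21 !mulr_gt0 ?d10 ?d20 ?pos.
exists M0; split=> // M /M0P /=; rewrite mul1r.
case/and5P => M3 eA ecb eca /and5P[ebc eba eab eabc _].
(* Each product of a constant of the list with M exceeds 3, which outweighs the
   lower-order term in every comparison below. *)
have M0' : 0 < M by lra.
have MM : M <= M ^+ 2 by nra.
split.
  move=> /(_ player1 sb) super.
  have dge0 := discount_ge0 (discount player1).
  have gge0 x : 0 <= payoff_g M player1 x.
    by case/andP: (payoff_g_bound player1 x M3).
  have := supermartingale_step_le sa markovP dge0 gge0 super.
  have -> : delta player1 0%N = 1 by case: (discount player1).
  by rewrite /= -/p; nra.
case=> S [T [eqS eqT]].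
have disj := S_disjoint_T markovP discount M3 eqS.
have [Sc|Tc] := c_stopped markovP discount M3 eqS eqT eA.
  have nTa : ~ T sa.
    move=> Ta; have := player1_other_step markovP discount M3 eqS Sc Ta.
    by rewrite /= -/p; nra.
  have [Sb|Tb] := b_stopped markovP discount Ppos M3 eqS nTa (or_introl Sc).
    have := player1_own_step markovP discount M3 eqS Sc Sb.
    by rewrite /= -/p; nra.
  have := player1_other_step markovP discount M3 eqS Sc Tb.
  by rewrite /= -/p; nra.
have nSc : ~ S sc by move=> /disj.
have nTb : ~ T sb.
  move=> Tb; have := player2_own_step markovP discount M3 eqS eqT Tb Tc.
  by rewrite /= -/p; nra.
have [nTa|] := EM (~ T sa).
  have [Sb|//] := b_stopped markovP discount Ppos M3 eqS nTa (or_intror Tc).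
  have [Sa|//] := a_stopped markovP discount Pac M3 eqS eqT eA Sb Tc.
  have := player1_own_step markovP discount M3 eqS Sa Sb.
  by rewrite /= -/p; nra.
move=> /contrapT Ta; have nSa : ~ S sa by move=> /disj.
have [Sb|nSb] := EM (S sb).
  have := player1_other_step markovP discount M3 eqS Sb Ta.
  by rewrite /= -/p; nra.
have := player2_own_two_steps markovP discount M3 eqS eqT Ta nSb nTb Tc.
by rewrite /= -/p; nra.
Qed.
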